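(* Let $(A,\cdot,\Phi=\{\partial_1,\partial_2\})$ be a commutative differential algebra. Let $\eth_1,\eth_2\colon A\to A$ be linear maps and suppose that there is a commutative differential algebra structure $(A^*,\circ,\Psi^*=\{\eth_1^*,\eth_2^*\})$ on $A^*$. Let $(A,[\ ,\ ]_A,\cdot)$ and $(A^*,[\ ,\ ]_{A^*},\circ)$ be the induced Poisson algebras of $(A,\cdot,\Phi)$ and $(A^*,\circ,\Psi^* )$ respectively. Let $\Delta\colon A\to A\otimes A$ denote the linear dual of the multiplication $\circ\colon A^*\otimes A^*\to A^*$. Suppose that $(A\bowtie A^*,\star,\Phi+\Psi^*,\mathfrak B_d)$ is a double construction of commutative differential Frobenius algebra associated to $(A,\cdot,\Phi)$ and $(A^*,\circ,\Psi^* )$. Then there is a Manin triple $((A\oplus A^*,[\ ,\ ],\star,\mathfrak B_d),A,A^* )$ of Poisson algebras such that the Poisson algebra structure on $A\oplus A^*$ is the induced Poisson algebra of $(A\bowtie A^*,\star,\Phi+\Psi^* )$ if and only if the following equations hold: $$\eth_2(\partial_1(a))\cdot b=\eth_1(\partial_2(a))\cdot b\quad\text{for all }a,b\in A,\qquad(\eth_2\partial_1\otimes\mathrm{id})\Delta=(\eth_1\partial_2\otimes\mathrm{id})\Delta.$$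
   Context: All vector spaces and algebras are finite-dimensional over a field $\mathbb F$ of characteristic $0$; ''algebra'' means associative algebra, not necessarily unital. Transposes are denoted by $*$. Commutative differential algebra $(A,\cdot,\{\partial_1,\partial_2\})$: commutative algebra with commuting derivations $\partial_1,\partial_2$. Its induced Poisson algebra is $(A,[\ ,\ ],\cdot)$ with $[a,b]=\partial_1(a)\cdot\partial_2(b)-\partial_2(a)\cdot\partial_1(b)$. (Poisson algebra: $[\ ,\ ]$ a Lie bracket, $\cdot$ commutative associative, $[a,b\cdot c]=[a,b]\cdot c+b\cdot[a,c]$.) $\Phi+\Psi^*=\{\partial_1+\eth_1^*,\partial_2+\eth_2^*\}$, where $\partial_k+\eth_k^*$ is the map $a+a^*\mapsto\partial_k(a)+\eth_k^*(a^* )$ on $A\oplus A^*$. $\mathfrak B_d(a+a^*,b+b^* )=\langle a,b^*\rangle+\langle a^*,b\rangle$ on $A\oplus A^*$. A double construction of commutative differential Frobenius algebra associated to $(A,\cdot,\Phi)$ and $(A^*,\circ,\Psi^* )$ is a commutative algebra structure $\star$ on $A\oplus A^*$ containing $(A,\cdot)$ and $(A^*,\circ)$ as subalgebras, such that $\mathfrak B_d(x\star y,z)=\mathfrak B_d(x,y\star z)$ for all $x,y,z$, and $(A\oplus A^*,\star,\Phi+\Psi^* )$ is a differential algebra; it is denoted $(A\bowtie A^*,\star,\Phi+\Psi^*,\mathfrak B_d)$. A bilinear form $\mathfrak B$ on a Poisson algebra is invariant if $\mathfrak B([a,b],c)=\mathfrak B(a,[b,c])$ and $\mathfrak B(a\cdot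 b,c)=\mathfrak B(a,b\cdot c)$. A Manin triple of Poisson algebras $((P,[\ ,\ ],\cdot,\mathfrak B),P^+,P^-)$: $(P,[\ ,\ ],\cdot)$ is a Poisson algebra, $\mathfrak B$ is a nondegenerate symmetric invariant bilinear form on it, $P^\pm$ are Poisson subalgebras, $P=P^+\oplus P^-$ as vector spaces, and $P^+$, $P^-$ are isotropic for $\mathfrak B$. *)

(* Defs.v *)
From HB Require Import structures.
From mathcomp Require Import all_boot all_order all_algebra.

Set Implicit Arguments.
Unset Strict Implicit.
Unset Printing Implicit Defensive.

Import GRing.Theory.
Local Open Scope ring_scope.

Section Dual.
Variable F : fieldType.

(* Through F^o, the field F is seen as a one-dimensional F-space. *)
Definition dual (V : vectType F) : vectType F := 'Hom(V, F^o).

Definition transpose (V W : vectType F) (f : 'Hom(V, W)) :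
    'Hom(dual W, dual V) :=
  linfun (fun phi : dual W => (phi \o f)%VF).

Lemma transposeE (V W : vectType F) (f : 'Hom(V, W)) (phi : dual W) v :
  transpose f phi v = phi (f v).
Proof.
have lin : linear (fun phi : dual W => (phi \o f)%VF).
  by move=> k p q; rewrite comp_lfunDl comp_lfunZl.
pose g := GRing.isLinear.Build _ _ _ _ _ lin.
pose G : {linear dual W -> dual V} := HB.pack (fun phi : dual W => (phi \o f)%VF) g.
by rewrite /transpose (lfunE G) /= comp_lfunE.
Qed.

Lemma lfun_of_linear (U V : vectType F) (f : U -> V) :
  linear f -> linfun f =1 f.
Proof.
move=> lin; pose g := GRing.isLinear.Build _ _ _ _ _ lin.
pose G : {linear U -> V} := HB.pack f g.
exact: (lfunE G).
Qed.

End Dual.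

Section TensorProduct.
Variable F : fieldType.

(* V (x) W is realised, for finite-dimensional V and W, as the space of
   bilinear forms on V^* x W^*, with v (x) w : (phi, psi) |-> phi(v) psi(w).
   The universal property is tensor_universal below. *)
Definition tensor (V W : vectType F) : vectType F :=
  'Hom(dual V, dual (dual W)).

Definition tens (V W : vectType F) (v : V) (w : W) : tensor V W :=
  linfun (fun phi : dual V =>
    linfun (fun psi : dual W => (phi v * psi w : F^o)) : dual (dual W)).

Definition tensor_map (V W V' W' : vectType F)
    (f : 'Hom(V, V')) (g : 'Hom(W, W')) : 'Hom(tensor V W, tensor V' W') :=
  linfun (fun t : tensor V W =>
    (transpose (transpose g) \o t \o transpose f)%VF).

Lemma tensE (V W : vectType F) (v : V) (w : W) phi psi :
  tens v w phi psi = phi v * psi w.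
Proof.
have lin2 (p : dual V) : linear (fun psi : dual W => (p v * psi w : F^o)).
  move=> k q r; rewrite add_lfunE scale_lfunE.
  by rewrite /GRing.scale /= mulrDr mulrCA.
have lin1 : linear (fun p : dual V =>
    linfun (fun q : dual W => (p v * q w : F^o)) : dual (dual W)).
  move=> k p q; apply/lfunP => r; rewrite [RHS]add_lfunE.
  rewrite [X in _ = X + _]scale_lfunE !(lfun_of_linear (lin2 _)).
  rewrite add_lfunE scale_lfunE.
  by rewrite /GRing.scale /= mulrDl -mulrA.
by rewrite /tens (lfun_of_linear lin1) (lfun_of_linear (lin2 phi)).
Qed.

Lemma tensor_mapE (V W V' W' : vectType F)
    (f : 'Hom(V, V')) (g : 'Hom(W, W')) (t : tensor V W) phi psi :
  tensor_map f g t phi psi = t (transpose f phi) (transpose g psi).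
Proof.
rewrite /tensor_map lfun_of_linear.
  by rewrite !comp_lfunE transposeE.
by move=> k p q; rewrite comp_lfunDr comp_lfunDl -comp_lfunZr -comp_lfunZl.
Qed.

Lemma tensor_map_tens (V W V' W' : vectType F)
    (f : 'Hom(V, V')) (g : 'Hom(W, W')) v w :
  tensor_map f g (tens v w) = tens (f v) (g w).
Proof.
by apply/lfunP => phi; apply/lfunP => psi; rewrite tensor_mapE !tensE !transposeE.
Qed.

Let e (V : vectType F) := vbasis {:V}.

Let edual (V : vectType F) i : dual V := linfun (coord (e V) i : V -> F^o).

Lemma dual_expand (V : vectType F) (phi : dual V) :
  phi = \sum_(i < \dim {:V}) phi (e V)`_i *: edual i.
Proof.
apply/lfunP => v; rewrite sum_lfunE.
rewrite {1}(coord_vbasis (memvf v)) linear_sum /=.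
apply: eq_bigr => i _; rewrite linearZ /= scale_lfunE lfunE /=.
by rewrite /GRing.scale /= mulrC.
Qed.

Lemma tensor_expand (V W : vectType F) (t : tensor V W) :
  t = \sum_(i < \dim {:V}) \sum_(j < \dim {:W}) t (edual i) (edual j) *: tens (e V)`_i (e W)`_j.
Proof.
apply/lfunP => phi; apply/lfunP => psi.
rewrite {1}(dual_expand phi) linear_sum /= !sum_lfunE.
apply: eq_bigr => i _; rewrite linearZ /= scale_lfunE /=.
rewrite {1}(dual_expand psi) linear_sum /= !sum_lfunE scaler_sumr.
apply: eq_bigr => j _; rewrite linearZ /= !scale_lfunE tensE /GRing.scale /=.
by rewrite mulrA mulrC.
Qed.

Theorem tensor_universal (V W U : vectType F) (b : V -> W -> U) :
    bilinear_for *:%R *:%R b ->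
  exists! h : 'Hom(tensor V W, U), forall v w, h (tens v w) = b v w.
Proof.
move=> [bl br].
pose H (t : tensor V W) : U :=
  \sum_(i < \dim {:V}) \sum_(j < \dim {:W}) t (edual i) (edual j) *: b (e V)`_i (e W)`_j.
have linH : linear H.
  move=> k s t; rewrite /H scaler_sumr -big_split; apply: eq_bigr => i _.
  rewrite scaler_sumr -big_split; apply: eq_bigr => j _ /=.
  by rewrite !(add_lfunE, scale_lfunE) scalerDl scalerA.
have suml (I : finType) (c : I -> F) x w :
    b (\sum_i c i *: x i) w = \sum_i c i *: b (x i) w.
  pose G : {linear V -> U} := HB.pack (b^~ w) (GRing.isLinear.Build _ _ _ _ _ (bl w)).
  rewrite [LHS](linear_sum G); apply: eq_bigr => i _; exact: (linearZ_LR G).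
have sumr (I : finType) (c : I -> F) x v :
    b v (\sum_i c i *: x i) = \sum_i c i *: b v (x i).
  pose G : {linear W -> U} := HB.pack (b v) (GRing.isLinear.Build _ _ _ _ _ (br v)).
  rewrite [LHS](linear_sum G); apply: eq_bigr => i _; exact: (linearZ_LR G).
exists (linfun H); split=> [v w | h hE].
  rewrite lfun_of_linear // /H.
  rewrite [in RHS](coord_vbasis (memvf v)) suml; apply: eq_bigr => i _.
  rewrite [in RHS](coord_vbasis (memvf w)) sumr scaler_sumr; apply: eq_bigr => j _.
  by rewrite tensE !lfunE /= scalerA.
apply/lfunP => t; rewrite lfun_of_linear // {2}(tensor_expand t) linear_sum.
apply: eq_bigr => i _; rewrite linear_sum; apply: eq_bigr => j _.
by rewrite linearZ /= hE.
Qed.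

(* The linear dual Delta : V -> V (x) V of a product on V^*, i.e.
   < phi (x) psi, Delta(v) > = < phi o psi, v >. *)
Definition comult (V : vectType F) (circ : dual V -> dual V -> dual V) :
    'Hom(V, tensor V V) :=
  linfun (fun v : V =>
    linfun (fun phi : dual V =>
      linfun (fun psi : dual V => circ phi psi v : F^o) : dual (dual V))
    : tensor V V).

Lemma comultE (V : vectType F) (circ : dual V -> dual V -> dual V) :
    bilinear_for *:%R *:%R circ ->
  forall v phi psi, comult circ v phi psi = circ phi psi v.
Proof.
move=> [cl cr] v phi psi.
have lin3 w p : linear (fun q : dual V => circ p q w : F^o).
  by move=> k q r; rewrite cr add_lfunE scale_lfunE.
have lin2 w : linear (fun p : dual V =>
    linfun (fun q : dual V => circ p q w : F^o) : dual (dual V)).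
  move=> k p q; apply/lfunP => r; rewrite add_lfunE scale_lfunE.
  by rewrite !(lfun_of_linear (lin3 _ _)) cl add_lfunE scale_lfunE.
have lin1 : linear (fun w : V =>
    linfun (fun p : dual V =>
      linfun (fun q : dual V => circ p q w : F^o) : dual (dual V))
    : tensor V V).
  move=> k w x; apply/lfunP => p; rewrite add_lfunE scale_lfunE.
  rewrite !(lfun_of_linear (lin2 _)); apply/lfunP => q.
  by rewrite add_lfunE scale_lfunE !(lfun_of_linear (lin3 _ _)) linearP.
by rewrite /comult (lfun_of_linear lin1) (lfun_of_linear (lin2 v))
  (lfun_of_linear (lin3 v phi)).
Qed.

End TensorProduct.

Section Algebras.
Variables (F : fieldType) (V : vectType F).
Implicit Types (mul br : V -> V -> V) (d : 'End(V)).

(* Algebras are not assumed unital. *)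
Record comm_algebra mul : Prop := CommAlgebra {
  comm_algebra_bilinear : bilinear_for *:%R *:%R mul;
  comm_algebra_assoc : associative mul;
  comm_algebra_comm : commutative mul }.

Definition derivation mul d : Prop :=
  forall a b, d (mul a b) = mul (d a) b + mul a (d b).

Record comm_diff_algebra mul d1 d2 : Prop := CommDiffAlgebra {
  diff_comm_algebra : comm_algebra mul;
  diff_derivation1 : derivation mul d1;
  diff_derivation2 : derivation mul d2;
  diff_commute : (d1 \o d2)%VF = (d2 \o d1)%VF }.

Record lie_bracket br : Prop := LieBracket {
  lie_bilinear : bilinear_for *:%R *:%R br;
  lie_alternating : forall a, br a a = 0;
  lie_jacobi : forall a b c,
    br a (br b c) + br b (br c a) + br c (br a b) = 0 }.

Record poisson_algebra br mul : Prop := PoissonAlgebra {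
  poisson_lie : lie_bracket br;
  poisson_comm_algebra : comm_algebra mul;
  poisson_leibniz : forall a b c,
    br a (mul b c) = mul (br a b) c + mul b (br a c) }.

Definition induced_bracket mul d1 d2 : V -> V -> V :=
  fun a b => mul (d1 a) (d2 b) - mul (d2 a) (d1 b).

Record nondeg_sym_form (B : V -> V -> F) : Prop := NondegSymForm {
  form_bilinear : bilinear_for *%R *%R B;
  form_symmetric : forall x y, B x y = B y x;
  form_nondegenerate : forall x, (forall y, B x y = 0) -> x = 0 }.

Definition invariant_for mul (B : V -> V -> F) : Prop :=
  forall x y z, B (mul x y) z = B x (mul y z).

Definition closed_under mul (U : {vspace V}) : Prop :=
  forall x y, x \in U -> y \in U -> mul x y \in U.

Definition isotropic (B : V -> V -> F) (U : {vspace V}) : Prop :=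
  forall x y, x \in U -> y \in U -> B x y = 0.

Record manin_triple br mul (B : V -> V -> F) (Pp Pm : {vspace V}) : Prop :=
  ManinTriple {
    manin_poisson : poisson_algebra br mul;
    manin_form : nondeg_sym_form B;
    manin_invariant_br : invariant_for br B;
    manin_invariant_mul : invariant_for mul B;
    manin_subalgebra_p : closed_under br Pp /\ closed_under mul Pp;
    manin_subalgebra_m : closed_under br Pm /\ closed_under mul Pm;
    manin_sum : (Pp + Pm)%VS = fullv;
    manin_direct : (Pp :&: Pm)%VS = 0%VS;
    manin_isotropic_p : isotropic B Pp;
    manin_isotropic_m : isotropic B Pm }.

End Algebras.

Definition preserves (F : fieldType) (U V : vectType F)
    (mulU : U -> U -> U) (mulV : V -> V -> V) (f : 'Hom(U, V)) : Prop :=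
  forall x y, f (mulU x y) = mulV (f x) (f y).

Section Double.
Variables (F : fieldType) (A : vectType F).

Definition double_space : vectType F := (A * dual A)%type.

Definition inA : 'Hom(A, double_space) := linfun (fun a : A => (a, 0) : double_space).
Definition inAd : 'Hom(dual A, double_space) :=
  linfun (fun f : dual A => (0, f) : double_space).

Definition pairing_form (x y : double_space) : F := y.2 x.1 + x.2 y.1.

(* double_map d e is the map d + e^* on A (+) A^*. *)
Definition double_map (d e : 'End(A)) : 'End(double_space) :=
  linfun (fun x : double_space => (d x.1, transpose e x.2) : double_space).

Lemma inAE a : inA a = (a, 0).
Proof.
rewrite /inA lfun_of_linear // => k x y.
by congr pair; rewrite /= scaler0 addr0.
Qed.

Lemma inAdE f : inAd f = (0, f).
Proof.
rewrite /inAd lfun_of_linear // => k x y.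
by congr pair; rewrite /= scaler0 addr0.
Qed.

Lemma double_mapE d e x : double_map d e x = (d x.1, transpose e x.2).
Proof.
rewrite /double_map lfun_of_linear // => k y z.
by congr pair; rewrite /= linearP.
Qed.

Record double_construction
    (mul : A -> A -> A) (circ : dual A -> dual A -> dual A)
    (d1 d2 e1 e2 : 'End(A)) (star : double_space -> double_space -> double_space) : Prop :=
  DoubleConstruction {
    double_comm_algebra : comm_algebra star;
    double_subalgebra : preserves mul star inA;
    double_subalgebra_dual : preserves circ star inAd;
    double_invariant : invariant_for star pairing_form;
    double_diff : comm_diff_algebra star (double_map d1 e1) (double_map d2 e2) }.

End Double.

(* Main.v *)
Require Import Defs.
From HB Require Import structures.
From mathcomp Require Import all_boot all_order all_algebra.
From mathcomp Require Import ring.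

Set Implicit Arguments.
Unset Strict Implicit.
Unset Printing Implicit Defensive.

Import GRing.Theory.
Local Open Scope ring_scope.

(** Everything except the invariance of the bracket is automatic: the bracket
    induced by two commuting derivations of a commutative algebra is always
    Poisson ([induced_poisson_algebra]), and both summands are isotropic
    subalgebras.  So the theorem asks when the induced bracket on
    D = A (+) A^* is invariant for the pairing.

    Let D1, D2 be the derivations of D, and D1', D2' their adjoints for the
    pairing.  Invariance of the product gives
      Dk' (x * y) = x * Dk' y - Dk x * y
    ([adjoint_derivation]).  Moving all operators to the right in the pairing of
    [x, y] with z produces D1' (D2 y * z) - D2' (D1 y * z), which by this rule
    equals [y, z] + T y * z, where T = D1' D2 - D2' D1
    ([adjoint_bracket]).  Hence the bracket is invariant iff T x * y = 0 for
    all x and y ([invariant_bracketP]).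

    Since the adjoint of d + e^* is e + d^*, the map T preserves both summands:
    it is e1 d2 - e2 d1 on A and the transpose of e2 d1 - e1 d2 on A^*.
    The two equations of the theorem therefore say precisely that T x * y
    vanishes when x and y lie in the same summand
    ([defect_annihilates_inA], [defect_annihilates_inAd]).  The remaining mixed
    products vanish as a consequence ([invariant_bracket_halves]): T is both a
    derivation and skew-adjoint, so for x in one summand and y, v in the other,
    < T x * y, v > = < T x, y * v > = - < x, T (y * v) > = 0, while for u in
    the summand of x, < T x * y, u > = < T x * u, y > = 0. *)

(** * Bilinear maps and identities between vectors *)

Section Bilinear.
Variables (F : fieldType) (U V : vectType F) (W : lmodType F).
Variables (b : U -> V -> W) (bilin_b : bilinear_for *:%R *:%R b).

Lemma bilinDl v : {morph b^~ v : x y / x + y}.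
Proof. by move=> x y; have /= := bilin_b.1 v 1 x y; rewrite !scale1r. Qed.

Lemma bilinDr u : {morph b u : x y / x + y}.
Proof. by move=> x y; have /= := bilin_b.2 u 1 x y; rewrite !scale1r. Qed.

Lemma bilin0l v : b 0 v = 0.
Proof. by apply: (addrI (b 0 v)); rewrite -bilinDl !addr0. Qed.

Lemma bilin0r u : b u 0 = 0.
Proof. by apply: (addrI (b u 0)); rewrite -bilinDr !addr0. Qed.

Lemma bilinNl v : {morph b^~ v : x / - x}.
Proof.
by move=> x; apply/eqP; rewrite -addr_eq0 -bilinDl addNr bilin0l.
Qed.

Lemma bilinNr u : {morph b u : x / - x}.
Proof.
by move=> x; apply/eqP; rewrite -addr_eq0 -bilinDr addNr bilin0r.
Qed.

Lemma bilinBl v : {morph b^~ v : x y / x - y}.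
Proof. by move=> x y; rewrite bilinDl bilinNl. Qed.

Lemma bilinBr u : {morph b u : x y / x - y}.
Proof. by move=> x y; rewrite bilinDr bilinNr. Qed.

Lemma bilinZl k u v : b (k *: u) v = k *: b u v.
Proof. by have /= := bilin_b.1 v k u 0; rewrite !addr0 bilin0l addr0. Qed.

Lemma bilinZr k u v : b u (k *: v) = k *: b u v.
Proof. by have /= := bilin_b.2 u k v 0; rewrite !addr0 bilin0r addr0. Qed.

End Bilinear.

Lemma eq_scalar_forms (F : fieldType) (V : vectType F) (u v : V) :
  (forall f : {scalar V}, f u = f v) -> u = v.
Proof.
move=> eq_uv; rewrite (coord_vbasis (memvf u)) (coord_vbasis (memvf v)).
by apply: eq_bigr => i _; rewrite (eq_uv (coord (vbasis {:V}) i)).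
Qed.

(** Closes an identity between linear combinations of vectors: under any linear
    form it becomes a ring identity over the scalars. *)
Ltac vector_ring :=
  let f := fresh "f" in
  apply: eq_scalar_forms => f;
  rewrite ?(linearD f, linearN f, scalarZ f, linear0 f); ring.

(** * The Poisson algebra of a commutative differential algebra *)

Section InducedPoisson.
Variables (F : fieldType) (V : vectType F) (mul : V -> V -> V).
Variables (d1 d2 : 'End(V)) (diff_mul : comm_diff_algebra mul d1 d2).

Let bilin := comm_algebra_bilinear (diff_comm_algebra diff_mul).
Let mulA := comm_algebra_assoc (diff_comm_algebra diff_mul).
Let mulC := comm_algebra_comm (diff_comm_algebra diff_mul).
Let der1 := diff_derivation1 diff_mul.
Let der2 := diff_derivation2 diff_mul.

Let d21 a : d2 (d1 a) = d1 (d2 a).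
Proof.
by have := diff_commute diff_mul => /lfunP/(_ a); rewrite !comp_lfunE.
Qed.

Let mulDl := bilinDl bilin.
Let mulDr := bilinDr bilin.
Let mulBl := bilinBl bilin.
Let mulBr := bilinBr bilin.
Let mulZl := bilinZl bilin.
Let mulZr := bilinZr bilin.

Let br := induced_bracket mul d1 d2.

(** Each monomial of the Jacobi sum is a product of one second derivative and
    two first derivatives; since d1 and d2 commute, they cancel in pairs. *)
Lemma induced_lie_bracket : lie_bracket br.
Proof.
split; rewrite /br /induced_bracket.
- split=> u k x y /=.
    rewrite !linearP /= !mulDl !mulZl scalerBr; vector_ring.
  rewrite !linearP /= !mulDr !mulZr scalerBr; vector_ring.
- by move=> a; rewrite mulC subrr.
move=> a b c.
have rot x y z : mul y (mul z x) = mul x (mul y z).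
  by rewrite mulA [LHS]mulC.
rewrite !linearB /= !(der1, der2) !d21 !(mulBr, mulDr).
(* Every monomial is brought to the form a' * (b' * c'), primes denoting
   derivatives. *)
rewrite !(rot _ (d1 c)) !(rot _ (d2 c)) !(rot _ (d1 b)) !(rot _ (d2 b)).
rewrite !(rot _ (d1 (d1 b))) !(rot _ (d1 (d2 b))) !(rot _ (d2 (d2 b))).
vector_ring.
Qed.

Lemma induced_poisson_algebra : poisson_algebra br mul.
Proof.
split; [exact: induced_lie_bracket | exact: diff_comm_algebra diff_mul |].
move=> a b c; rewrite /br /induced_bracket !(der1, der2).
have mulCA x y : mul x (mul b y) = mul b (mul x y) by rewrite !mulA (mulC x).
rewrite !(mulBl, mulBr, mulDr) !mulCA -!mulA; vector_ring.
Qed.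

End InducedPoisson.

(** * Invariance of the induced bracket *)

Section InvarianceCriterion.
Variables (F : fieldType) (V : vectType F) (mul : V -> V -> V).
Variables (B : V -> V -> F) (d1 d2 d1' d2' : 'End(V)).
Hypotheses (diff_mul : comm_diff_algebra mul d1 d2).
Hypotheses (form_B : nondeg_sym_form B) (inv_mul : invariant_for mul B).
Hypothesis adj1 : forall x y, B (d1 x) y = B x (d1' y).
Hypothesis adj2 : forall x y, B (d2 x) y = B x (d2' y).

Let bilin := comm_algebra_bilinear (diff_comm_algebra diff_mul).
Let mulA := comm_algebra_assoc (diff_comm_algebra diff_mul).
Let mulC := comm_algebra_comm (diff_comm_algebra diff_mul).

Let bilinB : bilinear_for *:%R *:%R (B : V -> V -> F^o) := form_bilinear form_B.
Let BDr := bilinDr bilinB.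
Let BDl := bilinDl bilinB.
Let BBr := bilinBr bilinB.
Let BBl := bilinBl bilinB.

Lemma form_injective u v : (forall x, B x u = B x v) -> u = v.
Proof.
move=> eq_uv; apply/eqP; rewrite -subr_eq0; apply/eqP.
apply: (form_nondegenerate form_B) => x.
by rewrite (form_symmetric form_B) BBr eq_uv subrr.
Qed.

(** Pair with z: < z, d' (x y) > = < (d z) x, y >, and d z * x is
    d (z x) - z * d x. *)
Lemma adjoint_derivation d d' : derivation mul d ->
    (forall x y, B (d x) y = B x (d' y)) ->
  forall x y, d' (mul x y) = mul x (d' y) - mul (d x) y.
Proof.
move=> der_d adj x y; apply: form_injective => z.
rewrite BBr -adj -!inv_mul -adj der_d BDl.
by rewrite addrK.
Qed.

(** The obstruction to invariance of the induced bracket: the operator T with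
    < [x, y], z > = < x, [y, z] + T y * z >. *)
Definition bracket_defect : 'End(V) := ((d1' \o d2) - (d2' \o d1))%VF.

Lemma bracket_defectE x : bracket_defect x = d1' (d2 x) - d2' (d1 x).
Proof. by rewrite /bracket_defect add_lfunE opp_lfunE !comp_lfunE. Qed.

(** Taking adjoints turns d1' d2 into d2' d1, so the defect is skew. *)
Lemma form_defect x y : B (bracket_defect x) y = - B x (bracket_defect y).
Proof.
have adj' d d' : (forall x y, B (d x) y = B x (d' y)) ->
    forall x y, B (d' x) y = B x (d y).
  move=> adj u v.
  by rewrite (form_symmetric form_B) -adj (form_symmetric form_B).
rewrite !bracket_defectE BBl BBr !(adj' _ _ adj1) !(adj' _ _ adj2).
by rewrite adj1 adj2 opprB.
Qed.

(** The factor y is the one kept outside when [adjoint_derivation] is applied to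
    the product of y and dk x: this leaves each dk' applied to dj x, which
    makes up the defect, and no dk' applied to y. *)
Lemma adjoint_bracket x y :
  d1' (mul (d2 x) y) - d2' (mul (d1 x) y) =
  induced_bracket mul d1 d2 x y + mul (bracket_defect x) y.
Proof.
rewrite bracket_defectE /induced_bracket (bilinBl bilin).
rewrite ![mul _ y]mulC.
rewrite (adjoint_derivation (diff_derivation1 diff_mul) adj1).
rewrite (adjoint_derivation (diff_derivation2 diff_mul) adj2).
rewrite ![mul (d1 y) _]mulC ![mul (d2 y) _]mulC.
vector_ring.
Qed.

(** Expanding the defect of x y by the Leibniz rule gives the left side of
    [adjoint_bracket] for (x, y) plus the one for (y, x); the two brackets
    cancel by antisymmetry. *)
Lemma defect_derivation : derivation mul bracket_defect.
Proof.
move=> x y; rewrite {1}bracket_defectE.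
rewrite (diff_derivation1 diff_mul) (diff_derivation2 diff_mul) !linearD /=.
have := adjoint_bracket x y; have := adjoint_bracket y x.
rewrite /induced_bracket ![mul _ x]mulC.
rewrite !(mulC (d1 x) (d2 y)) !(mulC (d1 y) (d2 x)).
move=> /(canRL (subrK _)) -> /(canRL (subrK _)) ->.
vector_ring.
Qed.

Lemma invariant_bracketP :
  invariant_for (induced_bracket mul d1 d2) B <->
  forall x y, mul (bracket_defect x) y = 0.
Proof.
have bracket_adj x y z : B (induced_bracket mul d1 d2 x y) z =
    B x (induced_bracket mul d1 d2 y z + mul (bracket_defect y) z).
  by rewrite BBl !inv_mul adj1 adj2 -BBr adjoint_bracket.
split=> [inv y z | zero x y z].
  apply: form_injective => x; rewrite (bilin0r bilinB).
  have := inv x y z; rewrite bracket_adj BDr => /(canRL (addKr _)) ->.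
  by rewrite addNr.
by rewrite bracket_adj zero addr0.
Qed.

(** Products of elements from different subspaces need not be checked: the
    defect is a derivation, so it kills the products inside Pp and inside Pm,
    and skewness of the defect carries this over to the mixed products. *)
Lemma invariant_bracket_halves (Pp Pm : {vspace V}) :
    (Pp + Pm)%VS = fullv ->
    {in Pp &, forall x y, mul (bracket_defect x) y = 0} ->
    {in Pm &, forall x y, mul (bracket_defect x) y = 0} ->
  invariant_for (induced_bracket mul d1 d2) B.
Proof.
move=> sumP zP zM; apply/invariant_bracketP.
have prod0 (P : {vspace V}) :
    {in P &, forall x y, mul (bracket_defect x) y = 0} ->
    {in P &, forall x y, bracket_defect (mul x y) = 0}.
  by move=> z x y Px Py; rewrite defect_derivation z // mulC z // addr0.
have decomp v : exists2 x, x \in Pp & exists2 y, y \in Pm & v = x + y.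
  have: v \in (Pp + Pm)%VS by rewrite sumP memvf.
  by case/memv_addP => x Px [y Py ->]; exists x => //; exists y.
have mixed (P Q : {vspace V}) :
    (forall v, exists2 x, x \in P & exists2 y, y \in Q & v = x + y) ->
    {in P &, forall x y, mul (bracket_defect x) y = 0} ->
    {in Q &, forall x y, mul (bracket_defect x) y = 0} ->
    {in P & Q, forall x y, mul (bracket_defect x) y = 0}.
  move=> PQ zP' zQ' x y Px Qy; apply: form_injective => w.
  have [u Pu [v Qv ->]] := PQ w.
  rewrite (bilin0r bilinB) BDl.
  (* The test vector has u on the side of x and v on the side of y. *)
  rewrite -inv_mul (mulC u) zP' // (bilin0l bilinB) add0r.
  rewrite (form_symmetric form_B v) inv_mul.
  by rewrite form_defect (prod0 Q) // (bilin0r bilinB) oppr0.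
move=> x y; have [xp Pxp [xm Pxm ->]] := decomp x.
have [yp Pyp [ym Pym ->]] := decomp y.
rewrite linearD /= !(bilinDl bilin, bilinDr bilin).
rewrite (zP xp yp) // (zM xm ym) // (mixed Pp Pm decomp zP zM xp ym) //.
rewrite (mixed Pm Pp _ zM zP xm yp) ?addr0 // => v.
by have [a Pa [b Pb ->]] := decomp v; exists b => //; exists a => //;
  rewrite addrC.
Qed.

End InvarianceCriterion.

(** * The double space and its pairing *)

Section DoubleSpace.
Variables (F : fieldType) (A : vectType F).
Implicit Types (d e : 'End(A)) (x y : double_space A).

Lemma pairing_nondeg_sym_form : nondeg_sym_form (@pairing_form F A).
Proof.
split.
- split=> [y | x] k u v; rewrite /pairing_form /=.
    by rewrite linearP add_lfunE scale_lfunE mulrDr [RHS]addrACA.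
  by rewrite linearP add_lfunE scale_lfunE mulrDr [RHS]addrACA.
- by move=> x y; rewrite /pairing_form addrC.
move=> [a f] orth; congr pair.
  apply: eq_scalar_forms => g; rewrite linear0.
  have := orth (0, linfun (g : A -> F^o)).
  by rewrite /pairing_form /= linear0 addr0 lfunE.
apply/lfunP => b; have := orth (b, 0).
by rewrite /pairing_form /= zero_lfunE add0r => ->; rewrite zero_lfunE.
Qed.

Lemma pairing_adjoint d e x y :
  pairing_form (double_map d e x) y = pairing_form x (double_map e d y).
Proof. by rewrite /pairing_form !double_mapE /= !transposeE. Qed.

Lemma double_map_inA d e a : double_map d e (inA A a) = inA A (d a).
Proof. by rewrite !inAE double_mapE /= linear0. Qed.

Lemma double_map_inAd d e f :
  double_map d e (inAd A f) = inAd A (transpose e f).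
Proof. by rewrite !inAdE double_mapE /= linear0. Qed.

Lemma double_space_sum : (limg (inA A) + limg (inAd A))%VS = fullv.
Proof.
apply/eqP; rewrite eqEsubv subvf; apply/subvP => -[a f] _.
apply/memv_addP; exists (inA A a); first exact: memv_img (memvf a).
exists (inAd A f); first exact: memv_img (memvf f).
rewrite inAE inAdE; congr pair; by rewrite ?addr0 ?add0r.
Qed.

Lemma double_space_direct : (limg (inA A) :&: limg (inAd A))%VS = 0%VS.
Proof.
apply/eqP; rewrite -subv0; apply/subvP => x; rewrite memv_cap memv0.
case/andP=> /memv_imgP[a _ ->] /memv_imgP[f _].
by rewrite inAE inAdE => -[-> _].
Qed.

Lemma isotropic_inA : isotropic (@pairing_form F A) (limg (inA A)).
Proof.
move=> _ _ /memv_imgP[a _ ->] /memv_imgP[b _ ->].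
by rewrite !inAE /pairing_form /= !zero_lfunE addr0.
Qed.

Lemma isotropic_inAd : isotropic (@pairing_form F A) (limg (inAd A)).
Proof.
move=> _ _ /memv_imgP[f _ ->] /memv_imgP[g _ ->].
by rewrite !inAdE /pairing_form /= !linear0 addr0.
Qed.

Lemma inA_inj : injective (inA A).
Proof. by move=> a b; rewrite !inAE => -[]. Qed.

Lemma inAd_inj : injective (inAd A).
Proof. by move=> f g; rewrite !inAdE => -[]. Qed.

End DoubleSpace.

(** * Subalgebras as images of embeddings *)

Lemma preserves_closed (F : fieldType) (U V : vectType F)
    (mulU : U -> U -> U) (mulV : V -> V -> V) (f : 'Hom(U, V)) :
  preserves mulU mulV f -> closed_under mulV (limg f).
Proof.
move=> f_mul _ _ /memv_imgP[x _ ->] /memv_imgP[y _ ->].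
by rewrite -f_mul memv_img ?memvf.
Qed.

Lemma preserves_induced_bracket (F : fieldType) (U V : vectType F)
    (mulU : U -> U -> U) (mulV : V -> V -> V) (f : 'Hom(U, V))
    (d1 d2 : 'End(U)) (D1 D2 : 'End(V)) :
    preserves mulU mulV f ->
    (forall x, D1 (f x) = f (d1 x)) -> (forall x, D2 (f x) = f (d2 x)) ->
  preserves (induced_bracket mulU d1 d2) (induced_bracket mulV D1 D2) f.
Proof.
move=> f_mul f_d1 f_d2 x y.
by rewrite /induced_bracket !f_d1 !f_d2 linearB /= !f_mul.
Qed.

(** * Equations on the dual comultiplication *)

(** Evaluated at forms f and g, applying a map s to the first tensor factor of
    the comultiplication composes f with s, by duality. *)
Lemma comult_mapP (F : fieldType) (A : vectType F)
    (circ : dual A -> dual A -> dual A) (s t : 'End(A)) :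
    bilinear_for *:%R *:%R circ ->
  (tensor_map s \1 \o comult circ)%VF = (tensor_map t \1 \o comult circ)%VF <->
  (forall f g, circ (transpose s f) g = circ (transpose t f) g).
Proof.
move=> bilin.
have transpose1 (g : dual A) : transpose \1%VF g = g.
  by apply/lfunP => v; rewrite transposeE id_lfunE.
have mapE (r : 'End(A)) v f g :
    (tensor_map r \1 \o comult circ)%VF v f g = circ (transpose r f) g v.
  by rewrite comp_lfunE tensor_mapE comultE // transpose1.
split=> [eq_st f g | eq_st].
  by apply/lfunP => v; rewrite -!mapE eq_st.
by apply/lfunP => v; apply/lfunP => f; apply/lfunP => g; rewrite !mapE eq_st.
Qed.

(** * The defect of a double construction *)

Section Double.
Variables (F : fieldType) (A : vectType F) (mul : A -> A -> A).
Variables (d1 d2 e1 e2 : 'End(A)) (circ : dual A -> dual A -> dual A).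
Variables (star : double_space A -> double_space A -> double_space A).

Let defect := bracket_defect (double_map d1 e1) (double_map d2 e2)
                             (double_map e1 d1) (double_map e2 d2).

Lemma defect_inA a : defect (inA A a) = inA A (e1 (d2 a) - e2 (d1 a)).
Proof. by rewrite bracket_defectE !double_map_inA linearB. Qed.

Lemma defect_inAd f : defect (inAd A f) =
  inAd A (transpose (e2 \o d1) f - transpose (e1 \o d2) f).
Proof.
rewrite bracket_defectE !double_map_inAd linearB /=.
congr (inAd A _ - inAd A _); apply/lfunP => v;
  by rewrite !transposeE comp_lfunE.
Qed.

Hypothesis bilin_mul : bilinear_for *:%R *:%R mul.
Hypothesis bilin_circ : bilinear_for *:%R *:%R circ.
Hypothesis sub_mul : preserves mul star (inA A).
Hypothesis sub_circ : preserves circ star (inAd A).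

Lemma defect_annihilates_inA :
  {in limg (inA A) &, forall x y, star (defect x) y = 0} <->
  (forall a b, mul (e2 (d1 a)) b = mul (e1 (d2 a)) b).
Proof.
split=> [zero a b | eq_mul _ _ /memv_imgP[a _ ->] /memv_imgP[b _ ->]].
  have := zero (inA A a) (inA A b)
    (memv_img _ (memvf _)) (memv_img _ (memvf _)).
  rewrite defect_inA -sub_mul -(linear0 (inA A)) => /inA_inj/eqP.
  by rewrite (bilinBl bilin_mul) subr_eq0 => /eqP.
by rewrite defect_inA -sub_mul (bilinBl bilin_mul) eq_mul subrr linear0.
Qed.

Lemma defect_annihilates_inAd :
  {in limg (inAd A) &, forall x y, star (defect x) y = 0} <->
  (tensor_map (e2 \o d1) \1 \o comult circ)%VF =
  (tensor_map (e1 \o d2) \1 \o comult circ)%VF.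
Proof.
rewrite comult_mapP //.
split=> [zero f g | eq_circ _ _ /memv_imgP[f _ ->] /memv_imgP[g _ ->]].
  have := zero (inAd A f) (inAd A g)
    (memv_img _ (memvf _)) (memv_img _ (memvf _)).
  rewrite defect_inAd -sub_circ -(linear0 (inAd A)) => /inAd_inj/eqP.
  by rewrite (bilinBl bilin_circ) subr_eq0 => /eqP.
by rewrite defect_inAd -sub_circ (bilinBl bilin_circ) eq_circ subrr linear0.
Qed.

End Double.

(** * The Manin triple *)

Theorem proposition5p18 (F : fieldType) (charF0 : [pchar F] =i pred0)
    (A : vectType F) (mul : A -> A -> A) (d1 d2 : 'End(A))
    (hA : comm_diff_algebra mul d1 d2)
    (e1 e2 : 'End(A)) (circ : dual A -> dual A -> dual A)
    (hAd : comm_diff_algebra circ (transpose e1) (transpose e2))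
    (star : double_space A -> double_space A -> double_space A)
    (hD : double_construction mul circ d1 d2 e1 e2 star) :
  (exists br : double_space A -> double_space A -> double_space A,
     [/\ manin_triple br star (@pairing_form F A)
           (limg (inA A)) (limg (inAd A)),
         preserves (induced_bracket mul d1 d2) br (inA A),
         preserves (induced_bracket circ (transpose e1) (transpose e2)) br
           (inAd A)
       & forall x y, br x y =
           induced_bracket star (double_map d1 e1) (double_map d2 e2) x y])
  <->
  (forall a b, mul (e2 (d1 a)) b = mul (e1 (d2 a)) b) /\
  (tensor_map (e2 \o d1) \1 \o comult circ)%VF =
  (tensor_map (e1 \o d2) \1 \o comult circ)%VF.
Proof.
have [_ sub_mul sub_circ inv_star diff_star] := hD.
have bilin_mul := comm_algebra_bilinear (diff_comm_algebra hA).
have bilin_circ := comm_algebra_bilinear (diff_comm_algebra hAd).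
set D1 := double_map d1 e1 in diff_star *.
set D2 := double_map d2 e2 in diff_star *.
have form := pairing_nondeg_sym_form A.
have adj1 := pairing_adjoint d1 e1; have adj2 := pairing_adjoint d2 e2.
rewrite -(defect_annihilates_inA _ _ _ _ bilin_mul sub_mul).
rewrite -(defect_annihilates_inAd _ _ _ _ bilin_circ sub_circ).
split=> [[br [triple _ _ br_induced]] | [zA zAd]].
  have inv_br : invariant_for (induced_bracket star D1 D2) (@pairing_form F A).
    by move=> x y z; rewrite -!br_induced; exact: (manin_invariant_br triple).
  have zero := (invariant_bracketP diff_star form inv_star adj1 adj2).1 inv_br.
  by split=> x y _ _; apply: zero.
have brA : preserves (induced_bracket mul d1 d2)
    (induced_bracket star D1 D2) (inA A).
  by apply: preserves_induced_bracket => // a; apply: double_map_inA.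
have brAd : preserves (induced_bracket circ (transpose e1) (transpose e2))
    (induced_bracket star D1 D2) (inAd A).
  by apply: preserves_induced_bracket => // f; apply: double_map_inAd.
exists (induced_bracket star D1 D2); split=> //; split=> //.
- exact: induced_poisson_algebra.
- exact: invariant_bracket_halves (double_space_sum A) zA zAd.
- by split; apply: preserves_closed; [exact: brA | exact: sub_mul].
- by split; apply: preserves_closed; [exact: brAd | exact: sub_circ].
- exact: double_space_sum.
- exact: double_space_direct.
- exact: isotropic_inA.
- exact: isotropic_inAd.
Qed.
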